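(* For $1\le t\le K$ let: $\Omega_t$ be a Polish space with a $\sigma$-additive $\sigma$-finite Borel measure $P_t$; $\mathcal P_t$ be a family of Borel probability densities on $\Omega_t$ with respect to $P_t$; $X_{it}\subset\mathcal P_t$ ($1\le i\le m_t$) and $Y_{jt}\subset\mathcal P_t$ ($1\le j\le n_t$) be nonempty sets; and $\phi_{ijt}:\Omega_t\to\mathbb R$ be Borel functions and $\epsilon_{ijt}>0$ be reals such that for all $i\le m_t,j\le n_t$ $$\int_{\Omega_t}e^{-\phi_{ijt}(\omega)}p(\omega)P_t(d\omega)\le\epsilon_{ijt}\ \ \forall p\in X_{it},\qquad \int_{\Omega_t}e^{\phi_{ijt}(\omega)}p(\omega)P_t(d\omega)\le\epsilon_{ijt}\ \ \forall p\in Y_{jt}.$$ Let $X_t=\bigcup_{i}X_{it}$, $Y_t=\bigcup_jY_{jt}$, $E_t=[\epsilon_{ijt}]_{i,j}\in\mathbb R^{m_t\times n_t}$, $\varepsilon_t=\|E_t\|_{2,2}$ (spectral norm), and let $g^t\in\mathbb R^{m_t}$, $h^t\in\mathbb R^{n_t}$ be entrywise positive vectors with $E_th^t=\varepsilon_tg^t$, $E_t^Tg^t=\varepsilon_th^t$ (they exist by the Perron--Frobenius theorem). Set $a_{ijt}=\ln(h^t_j/g^t_i)$, $$\phi_t(\omega_t)=\max_{1\le i\le m_t}\min_{1\le j\le n_t}[\phi_{ijt}(\omega_t)-a_{ijt}],\qquad \phi^K(\omega^K)=\sum_{t=1}^K\phi_t(\omega_t).$$ Then for every $t\le K$ $$\int_{\Omega_t}e^{-\phi_t(\omega)}p(\omega)P_t(d\omega)\le\varepsilon_t\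 \ \forall p\in X_t,\qquad \int_{\Omega_t}e^{\phi_t(\omega)}p(\omega)P_t(d\omega)\le\varepsilon_t\ \ \forall p\in Y_t.$$ As a result, for the hypotheses $H_1=H_X$ and $H_2=H_Y$ on the observation $\omega^K=(\omega_1,\dots,\omega_K)$ described in the context, the risk of the test which accepts $H_X$ when $\phi^K(\omega^K)\ge0$ and accepts $H_Y$ otherwise does not exceed $\prod_{t=1}^K\varepsilon_t$.
   Context: Hypotheses. According to hypothesis $H_\chi$, $\chi=1,2$ (with $H_1=H_X$, $H_2=H_Y$), the observations $\omega_t\in\Omega_t$, $t=1,\dots,K$, are generated as follows: there exists a sequence of latent random variables $\zeta_{1,\chi},\zeta_{2,\chi},\dots$ such that $\omega_t$ is a deterministic function of $\zeta^t_\chi=(\zeta_{1,\chi},\dots,\zeta_{t,\chi})$, and the conditional distribution of $\omega_t$ given $\zeta^{t-1}_\chi$ has density $p_t\in\mathcal P_t$ with respect to $P_t$, the density $p_t$ being a deterministic function of $\zeta_\chi^{t-1}$. Moreover, when $\chi=1$, $p_t$ always belongs to $X_t$, and when $\chi=2$, $p_t$ always belongs to $Y_t$. The risk of a test is the smallest $\epsilon$ such that, for both $\chi=1,2$ and for every distribution of $\omega^K$ allowed by $H_\chi$, the probability for the test to reject $H_\chi$ is at most $\epsilon$. *)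

(* Defs.v *)
From HB Require Import structures.
From mathcomp Require Import all_boot all_order all_algebra.
From mathcomp Require Import all_classical all_reals all_analysis.
From mathcomp Require Import measurable_realfun.

Set Implicit Arguments.
Unset Strict Implicit.
Unset Printing Implicit Defensive.

Import Order.TTheory GRing.Theory Num.Theory.
Import numFieldNormedType.Exports.

Local Open Scope classical_set_scope.
Local Open Scope ring_scope.

(* d is a metric on T that induces the topology of T and is complete. *)
Definition complete_metric_for (R : realType) (T : topologicalType)
    (d : T -> T -> R) : Prop :=
  [/\ forall x y, d x y = 0 <-> x = y,
      forall x y, d x y = d y x,
      forall x y z, d x z <= d x y + d y z,
      forall (x : T) (A : set T),
        nbhs x A <-> exists2 e : R, 0 < e & [set y | d x y < e] `<=` A
    & forall u : nat -> T,
        (forall e : R, 0 < e -> exists N : nat, forall p q : nat,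
          (N <= p)%N -> (N <= q)%N -> d (u p) (u q) < e) ->
        exists l : T, u @ \oo --> l].

Definition polish (R : realType) (T : topologicalType) : Prop :=
  (exists D : set T, countable D /\ dense D) /\
  (exists d : T -> T -> R, complete_metric_for d).

Definition borel (T : ptopologicalType) := g_sigma_algebraType (@open T).

Definition cylinders (I : Type) (d : I -> measure_display)
    (T : forall i, measurableType (d i)) : set (set (forall i, T i)) :=
  \bigcup_(i in [set: I])
    preimage_set_system setT (fun x : (forall i, T i) => x i) measurable.

(* The dependent product of the T i with the product sigma-algebra. *)
Definition prod_space (I : Type) (d : I -> measure_display)
    (T : forall i, measurableType (d i)) :=
  g_sigma_algebraType (@cylinders I d T).

Definition borel_densities (R : realType) (T : ptopologicalType)
    (mu : set (borel T) -> \bar R) : set (T -> R) :=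
  [set p | [/\ measurable_fun [set: borel T] (p : borel T -> R),
               forall w, 0 <= p w
             & (\int[mu]_w (p w)%:E = 1)%E]].

Definition l2norm (R : realType) (k : nat) (x : 'cV[R]_k) : R :=
  Num.sqrt (\sum_(i < k) x i 0 ^+ 2).

Definition spectral_norm (R : realType) (m n : nat) (A : 'M[R]_(m, n)) : R :=
  sup [set l2norm (A *m x) | x in [set x : 'cV[R]_n | l2norm x <= 1]].

Definition ord_maxr (R : realType) (k : nat) (F : 'I_k.+1 -> R) : R :=
  \big[Num.max/F ord0]_(i < k.+1) F i.

Definition ord_minr (R : realType) (k : nat) (F : 'I_k.+1 -> R) : R :=
  \big[Num.min/F ord0]_(i < k.+1) F i.

Definition aggregate (R : realType) (T : Type) (m n : nat)
    (phi : 'I_m.+1 -> 'I_n.+1 -> T -> R)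
    (g : 'cV[R]_m.+1) (h : 'cV[R]_n.+1) (w : T) : R :=
  ord_maxr (fun i => ord_minr (fun j => phi i j w - ln (h j 0 / g i 0))).

Section observations.
Context {R : realType} {K : nat} (Omega : 'I_K -> ptopologicalType).
Variable P : forall t, {sigma_finite_measure set (borel (Omega t)) -> \bar R}.

Definition obs_space := prod_space (fun t : 'I_K => borel (Omega t)).

Section latent.
Context {dS : measure_display} {S : measurableType dS}.
Variable Pr : probability S R.
Context {dZ : nat -> measure_display} {Z : forall k, measurableType (dZ k)}.
Variable zeta : forall k, S -> Z k.

Definition latent_space (k : nat) := prod_space (fun l : 'I_k => Z l).

(* The first k latent variables, zeta_0, ..., zeta_(k-1): since time t : 'I_K
   is counted from 0, the variables that precede (resp. are available at)
   time t are latent_history t (resp. latent_history t.+1). *)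
Definition latent_history (k : nat) : S -> latent_space k :=
  fun s (l : 'I_k) => zeta l s.
Arguments latent_history : clear implicits.

(* p (latent_history t) is, with respect to P t, a density of the conditional
   distribution of the observation w given latent_history t: for every Borel
   set B the integral of p over B is a version of the conditional probability
   of w \in B given the sigma-algebra generated by latent_history t. *)
Definition conditional_density (t : 'I_K) (w : S -> Omega t)
    (p : latent_space t -> Omega t -> R) : Prop :=
  forall B : set (borel (Omega t)), measurable B ->
    let q (s : S) : \bar R :=
      (\int[P t]_(x in B) (p (latent_history t s) x)%:E)%E in
    measurable_fun [set: g_sigma_algebra_preimageType (latent_history t)] q /\
    forall C : set (latent_space t), measurable C ->
      (Pr (latent_history t @^-1` C `&` w @^-1` B) =
       \int[Pr]_(s in latent_history t @^-1` C) q s)%E.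

Definition generated_by_latents (Pfam X : forall t, set (Omega t -> R))
    (omega : S -> obs_space) : Prop :=
  [/\ forall k, measurable_fun setT (zeta k),
      forall t : 'I_K, exists f : latent_space t.+1 -> borel (Omega t),
        measurable_fun setT f /\
        forall s, omega s t = f (latent_history t.+1 s)
    & forall t : 'I_K, exists p : latent_space t -> Omega t -> R,
        [/\ forall s, Pfam t (p (latent_history t s)),
            forall s, X t (p (latent_history t s))
          & conditional_density (fun s => omega s t) p]].

End latent.
Arguments latent_history {dS S dZ Z} zeta k s.

(* The distributions of (omega_t)_t allowed by the hypothesis attached to the
   sets X t; the probability space and the spaces of the latent variables are
   arbitrary. *)
Definition hypothesis (Pfam X : forall t, set (Omega t -> R)) :
    set (probability obs_space R) :=
  [set mu | exists (dS : measure_display) (S : measurableType dS)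
      (Pr : probability S R)
      (dZ : nat -> measure_display) (Z : forall k, measurableType (dZ k))
      (zeta : forall k, S -> Z k) (omega : S -> obs_space),
    generated_by_latents Pr zeta Pfam X omega /\
    forall A : set obs_space, measurable A -> mu A = Pr (omega @^-1` A)].

End observations.

(* The test accepts the first hypothesis on acc and the second one on its
   complement. *)
Definition risk (R : realType) (d : measure_display) (T : measurableType d)
    (H1 H2 : set (probability T R)) (acc : set T) : \bar R :=
  ereal_inf [set e%:E | e in [set e : R |
    (forall mu, H1 mu -> (mu (~` acc) <= e%:E)%E) /\
    (forall mu, H2 mu -> (mu acc <= e%:E)%E)]].

(* Main.v *)
Require Import Defs.
From HB Require Import structures.
From mathcomp Require Import all_boot all_order all_algebra.
From mathcomp Require Import finmap.
From mathcomp Require Import all_classical all_reals all_analysis.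
From mathcomp Require Import measurable_realfun.

(** The theorem has a deterministic and a probabilistic half.

    For one observation, bound the exponential of a maximum or of a minimum by a
    sum. If p belongs to the i-th X-set, the aggregated detector is at least its
    i-th row minimum, so exp(-phi_t) is at most the sum over j of
    (h_j / g_i) exp(-phi_ij), whose p-integral is at most (E h)_i / g_i, that is
    the spectral norm of E. If p belongs to the j-th Y-set, the detector is a row
    minimum for some row, hence at most the entry of that row in column j; so
    exp(phi_t) is at most the sum over i of (g_i / h_j) exp(phi_ij), and the
    transposed equation gives the same bound. These are
    [integral_expRN_aggregate_le] and [integral_expR_aggregate_le].

    For K observations, let G_t be exp(-phi_t) under the first hypothesis and
    exp(phi_t) under the second. Given the latent variables that precede t, the
    observation at time t has a density for which the integral of G_t is at most
    the spectral norm of E_t, while the factors G_u with u < t are functions of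
    those latent variables. The expectations of the partial products therefore
    grow by at most these norms ([expectation_prod_le]), and Markov's inequality
    bounds both error probabilities ([hypothesis_prob_le]).

    The conditional step works with integrals over events of the past.
    [integral_conditional_le] bounds the integral of G_t over each event of the
    past, and [ge0_le_integral_mul] replaces the event by a nonnegative function
    of the past. Both follow the usual path from indicators to simple functions
    to monotone limits, which is isolated in [integral_simple] and
    [integral_le_simple]. *)

Set Implicit Arguments.
Unset Strict Implicit.
Unset Printing Implicit Defensive.

Import Order.TTheory GRing.Theory Num.Theory.
Import numFieldNormedType.Exports.

Local Open Scope classical_set_scope.
Local Open Scope ring_scope.

(** * Integrals bounded through simple functions *)

Section simple_functions.
Local Open Scope ereal_scope.
Context d (S : measurableType d) d' (T : measurableType d') (R : realType).
Variables (mu : {measure set S -> \bar R}) (D : set S) (mD : measurable D).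
Variables (f : S -> T) (mf : measurable_fun [set: S] f).
Variables (W : S -> R) (W0 : forall s, (0 <= W s)%R).
Hypothesis mW : measurable_fun [set: S] W.

(** Simple functions are spelled out as finite combinations of indicators, not
    as bundled objects, so that the integral can be taken of their composition
    with [f]: the indicator of [A i] at [f s] is the indicator of [f @^-1` A i]
    at [s]. *)
Lemma integral_simple n (a : 'I_n -> R) (A : 'I_n -> set T) :
  (forall i, 0 <= a i)%R -> (forall i, measurable (A i)) ->
  \int[mu]_(s in D) ((\sum_(i < n) a i * \1_(A i) (f s)) * W s)%:E =
  \sum_(i < n) (a i)%:E * \int[mu]_(s in D `&` f @^-1` A i) (W s)%:E.
Proof.
move=> a0 mA.
have mfA i : measurable (f @^-1` A i).
  by rewrite -[X in measurable X]setTI; exact: mf.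
under eq_integral do rewrite mulr_suml -sumEFin.
have mWA i : measurable_fun D (EFin \o (fun s => \1_(A i) (f s) * W s)%R).
  apply/measurable_EFinP/measurable_funTS; apply: measurable_funM => //.
  exact: measurableT_comp.
rewrite ge0_integral_sum; [|by []| |]; last 2 first.
- move=> i; under eq_fun do rewrite -mulrA EFinM.
  by apply: emeasurable_funM => //; exact: mWA.
- by move=> i s _; rewrite lee_fin !mulr_ge0// indicE.
apply: eq_bigr => i _; under eq_integral do rewrite -mulrA EFinM.
rewrite ge0_integralZl_EFin//; last 2 first.
- by move=> s _; rewrite lee_fin mulr_ge0// indicE.
- exact: mWA.
congr (_ * _); rewrite integral_mkcondr; apply: eq_integral => s _.
rewrite patchE indicE; case: ifPn => [|] fs.
  by rewrite mem_set ?mul1r//; exact: (set_mem fs).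
rewrite memNset ?mul0r// => Afs.
by move/negP: fs; apply; exact: mem_set.
Qed.

Import HBNNSimple.

(** A bound on the integral of [F (f s) * W s] can be checked on the simple
    minorants of [F], by monotone convergence along dyadic approximations. Working with
    minorants lets the caller use upper bounds known for [F] itself. *)
Lemma integral_le_simple (F : T -> R) (c : \bar R) :
  (forall x, 0 <= F x)%R -> measurable_fun [set: T] F ->
  (forall n (a : 'I_n -> R) (A : 'I_n -> set T),
    (forall i, 0 <= a i)%R -> (forall i, measurable (A i)) ->
    (forall x, \sum_(i < n) a i * \1_(A i) x <= F x)%R ->
    \int[mu]_(s in D) ((\sum_(i < n) a i * \1_(A i) (f s)) * W s)%:E <= c) ->
  \int[mu]_(s in D) (F (f s) * W s)%:E <= c.
Proof.
move=> F0 mF simple_le.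
have mEF : measurable_fun [set: T] (EFin \o F) by exact/measurable_EFinP.
pose F_ := nnsfun_approx measurableT mEF.
have ndF x : nondecreasing_seq (F_ ^~ x).
  by move=> m n mn; exact/lefP/nd_nnsfun_approx.
have cvgF x : F_ n x @[n --> \oo] --> F x.
  have := @cvg_nnsfun_approx _ _ _ _ measurableT _ mEF (fun x _ => F0 x) x I.
  exact: fine_cvg.
have leF n x : (F_ n x <= F x)%R.
  rewrite -(cvg_lim (@Rhausdorff R) (cvgF x)).
  by apply: nondecreasing_cvgn_le; [exact: ndF | apply/cvg_ex; exists (F x)].
have -> : \int[mu]_(s in D) (F (f s) * W s)%:E =
    limn (fun n => \int[mu]_(s in D) (F_ n (f s) * W s)%:E).
  rewrite -monotone_convergence//.
  - apply: eq_integral => s _; apply/esym/cvg_lim => //.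
    apply: cvg_EFin; first exact: nearW.
    by apply: cvgM; [exact: cvgF | exact: cvg_cst].
  - move=> n; apply/measurable_EFinP/measurable_funTS/measurable_funM => //.
    exact: measurableT_comp.
  - by move=> n s _; rewrite lee_fin mulr_ge0.
  - by move=> s _ m n mn; rewrite lee_fin ler_wpM2r// ndF.
apply: lime_le.
  apply: ereal_nondecreasing_is_cvgn => m n mn; apply: ge0_le_integral => //.
  - by move=> s _; rewrite lee_fin mulr_ge0.
  - apply/measurable_EFinP/measurable_funTS/measurable_funM => //.
    exact: measurableT_comp.
  - apply/measurable_EFinP/measurable_funTS/measurable_funM => //.
    exact: measurableT_comp.
  - by move=> s _; rewrite lee_fin ler_wpM2r// ndF.
apply: nearW => n.
under eq_integral do rewrite (fimfunEord (F_ n)).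
apply: simple_le => [i|i|x].
- move: (mem_nth 0%R (ltn_ord i)); rewrite -[_ \in _]/(_ \in fset_set _).
  by rewrite in_fset_set// => /set_mem[x _ <-].
- by rewrite -[X in measurable X]setTI; exact: measurable_funP.
- by have := leF n x; rewrite [X in (X <= _)%R -> _](fimfunEord (F_ n)).
Qed.

End simple_functions.

(** If [W] has [f]-conditional expectation at most [c], in the sense of its
    integrals over the sets [f @^-1` A], then every nonnegative function of [f]
    can be carried along as a factor: both sides are additive and monotone in
    that factor, and the hypothesis is the case of an indicator. *)
Lemma ge0_le_integral_mul d (S : measurableType d) d' (T : measurableType d')
    (R : realType) (mu : {measure set S -> \bar R}) (f : S -> T) (W : S -> R)
    (F : T -> R) (c : R) :
  measurable_fun [set: S] f ->
  (forall s, 0 <= W s) -> measurable_fun [set: S] W ->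
  (forall x, 0 <= F x) -> measurable_fun [set: T] F -> 0 <= c ->
  (forall A, measurable A ->
    \int[mu]_(s in f @^-1` A) (W s)%:E <= c%:E * mu (f @^-1` A))%E ->
  (\int[mu]_s (F (f s) * W s)%:E <= c%:E * \int[mu]_s (F (f s))%:E)%E.
Proof.
move=> mf W0 mW F0 mF c0 Wc.
apply: integral_le_simple => // n a A a0 mA leF.
have mfA i : measurable (f @^-1` A i).
  by rewrite -[X in measurable X]setTI; exact: mf.
rewrite integral_simple//.
apply: (@le_trans _ _ (c%:E * \sum_(i < n) (a i)%:E * mu (f @^-1` A i))%E).
  rewrite ge0_sume_distrr; last by move=> i _; rewrite mule_ge0// lee_fin.
  apply: lee_sum => i _; rewrite setTI muleCA.
  by apply: lee_wpmul2l; [rewrite lee_fin|exact: Wc].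
apply: lee_wpmul2l; first by rewrite lee_fin.
have -> : (\sum_(i < n) (a i)%:E * mu (f @^-1` A i) =
    \int[mu]_s ((\sum_(i < n) a i * \1_(A i) (f s)) * cst 1 s)%:E)%E.
  rewrite (@integral_simple _ _ _ _ _ _ _ _ _ mf (cst 1))//.
  apply: eq_bigr => i _; rewrite setTI; congr (_ * _)%E.
  by apply/esym; apply: etrans (mul1e _); exact: integral_cst (mfA i) 1%E.
apply: ge0_le_integral => //.
- move=> s _; rewrite /= mulr1 lee_fin sumr_ge0// => i _.
  by rewrite mulr_ge0// indicE.
- apply/measurable_EFinP; under eq_fun do rewrite /= mulr1.
  apply: measurable_sum => i; apply: measurable_funM => //.
  exact: measurableT_comp.
- by apply/measurable_EFinP/measurableT_comp.
- by move=> s _; rewrite /= mulr1 lee_fin.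
Qed.

(** * Measurability in products *)

Section product_space.
Context (I : Type) (dT : I -> measure_display).
Context (T : forall i, measurableType (dT i)).

Lemma measurable_coord (i : I) :
  measurable_fun [set: prod_space T] (fun x : prod_space T => x i).
Proof.
by move=> _ A mA; apply: sub_sigma_algebra; exists i => //; exists A.
Qed.

Lemma measurable_prod_space d (S : measurableType d) (f : S -> prod_space T) :
  (forall i, measurable_fun [set: S] (fun s => f s i)) ->
  measurable_fun [set: S] f.
Proof.
move=> mf.
apply: (@measurability _ _ S (prod_space T) setT f (@cylinders I dT T)) => //.
move=> _ [_ [i _ [A mA <-]] <-].
by rewrite !setTI -[X in measurable X]setTI; exact: mf.
Qed.

End product_space.

(** * Products of weights of successive observations *)

Section likelihood_bound.
Context {R : realType} {K : nat} (Omega : 'I_K -> ptopologicalType).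
Variable P : forall t, {sigma_finite_measure set (borel (Omega t)) -> \bar R}.
Context {dS : measure_display} {S : measurableType dS} (Pr : probability S R).
Context {dZ : nat -> measure_display} {Z : forall k, measurableType (dZ k)}.
Variables (zeta : forall k, S -> Z k).
Hypothesis mzeta : forall k, measurable_fun [set: S] (zeta k).

Local Notation history k := (@latent_history dS S dZ Z zeta k).
Local Notation past k := (g_sigma_algebra_preimageType (history k)).

Lemma measurable_latent_history k : measurable_fun [set: S] (history k).
Proof. by apply: measurable_prod_space => l; exact: mzeta. Qed.

Lemma measurable_past k (A : set (past k)) :
  measurable A -> measurable (A : set S).
Proof. by case=> B mB <-; exact: measurable_latent_history. Qed.

Lemma measurable_latent_history_past k l : (l <= k)%N ->
  measurable_fun [set: past k] (history l : past k -> @latent_space dZ Z l).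
Proof.
move=> lk; apply: measurable_prod_space => i _ A mA; rewrite setTI.
have := @measurable_coord _ _ (fun j : 'I_k => Z j) (widen_ord lk i).
move=> /(_ measurableT A mA); rewrite setTI => mA'.
by exists ((fun x : @latent_space dZ Z k => x (widen_ord lk i)) @^-1` A);
  rewrite ?setTI.
Qed.

(** Conditionally on the past, [G (w s)] has expectation at most [c] because the
    bound holds for each of the densities [p (history t s)]. The defining
    property of [p] covers only events [w @^-1` B]; it extends to simple
    minorants of [G] by additivity. Passing to [G] itself for each fixed [s]
    leaves under the integral over [s] only finite combinations of integrals of
    [p (history t s)] over events, which are measurable in [s] by definition of
    a conditional density. *)
Lemma integral_conditional_le (t : 'I_K) (w : S -> Omega t)
    (p : @latent_space dZ Z t -> Omega t -> R) (G : Omega t -> R) (c : R)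
    (A : set (past t)) :
  measurable_fun [set: S] (w : S -> borel (Omega t)) ->
  conditional_density P Pr zeta w p ->
  (forall s, borel_densities (P t) (p (history t s))) ->
  (forall x, 0 <= G x) ->
  measurable_fun [set: borel (Omega t)] (G : borel (Omega t) -> R) ->
  (forall s, \int[P t]_x (G x * p (history t s) x)%:E <= c%:E)%E ->
  measurable A ->
  (\int[Pr]_(s in A) (G (w s))%:E <= c%:E * Pr A)%E.
Proof.
move=> mw pw dp G0 mG Gc mA; have mAS := measurable_past mA.
under eq_integral do rewrite -(mulr1 (G _)).
apply: (@integral_le_simple _ S _ (borel (Omega t)) R Pr A mAS w mw (cst 1))
  => //.
move=> n a B a0 mB leG.
rewrite (@integral_simple _ S _ (borel (Omega t)) R Pr A mAS w mw (cst 1))//.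
pose q i s := (\int[P t]_(x in B i) (p (history t s) x)%:E)%E.
have q0 i s : (0 <= q i s)%E.
  by apply: integral_ge0 => x _; rewrite lee_fin; case: (dp s).
have mq i : measurable_fun [set: S] (q i).
  move=> _ U mU; have [mqi _] := pw _ (mB i).
  by have := mqi measurableT _ mU; exact: measurable_past.
have mwB i : measurable (w @^-1` B i).
  by rewrite -[X in measurable X]setTI; exact: mw.
have int_q i : (\int[Pr]_(s in A `&` w @^-1` B i) (cst 1 s)%:E =
    \int[Pr]_(s in A) q i s)%E.
  transitivity (1 * Pr (A `&` w @^-1` B i))%E.
    exact: (integral_cst Pr (measurableI _ _ mAS (mwB i)) 1%E).
  rewrite mul1e; have [C mC <-] := mA; rewrite setTI.
  by have [_ ->] := pw _ (mB i).
apply: (@le_trans _ _ (\int[Pr]_(s in A) \sum_(i < n) (a i)%:E * q i s)%E).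
  rewrite ge0_integral_sum//; last 2 first.
  - by move=> i; apply: measurable_funTS; exact: measurable_funeM.
  - by move=> i s _; rewrite mule_ge0// lee_fin.
  rewrite le_eqVlt; apply/orP; left; apply/eqP; apply: eq_bigr => i _.
  by rewrite int_q ge0_integralZl_EFin//; exact: measurable_funTS.
apply: (@le_trans _ _ (\int[Pr]_(s in A) c%:E)%E); last by rewrite integral_cst.
have qc s : (\sum_(i < n) (a i)%:E * q i s <= c%:E)%E.
  have [mp p0 _] := dp s; apply: le_trans (Gc s).
  apply: (@le_trans _ _ (\int[P t]_x
      ((\sum_(i < n) a i * \1_(B i) (@idfun (borel (Omega t)) x)) *
       p (history t s) x)%:E)%E).
    rewrite integral_simple//; last exact: measurable_id.
    by apply: lee_sum => i _; rewrite setTI.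
  apply: ge0_le_integral => //.
  - move=> x _; rewrite lee_fin mulr_ge0// sumr_ge0// => i _.
    by rewrite mulr_ge0// indicE.
  - apply/measurable_EFinP/measurable_funM => //.
    apply: measurable_sum => i; apply: measurable_funM => //.
    exact: measurable_indic.
  - by apply/measurable_EFinP/measurable_funM.
  - by move=> x _; rewrite lee_fin ler_wpM2r.
apply: ge0_le_integral => //.
- by move=> s _; apply: sume_ge0 => i _; rewrite mule_ge0// lee_fin.
- apply: measurable_funTS; apply: emeasurable_sum => i.
  exact: measurable_funeM.
Qed.

Variables (Pfam X : forall t, set (Omega t -> R)).
Variable omega : S -> obs_space Omega.
Arguments Pfam : clear implicits.
Arguments X : clear implicits.
Hypothesis dPfam : forall t, Pfam t `<=` borel_densities (P t).
Hypothesis Homega : generated_by_latents P Pr zeta Pfam X omega.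
Variables (G : forall t, Omega t -> R) (c : 'I_K -> R).
Arguments G : clear implicits.
Hypothesis G0 : forall t x, 0 <= G t x.
Hypothesis mG : forall t,
  measurable_fun [set: borel (Omega t)] (G t : borel (Omega t) -> R).
Hypothesis c0 : forall t, 0 <= c t.
Hypothesis Gc : forall t p, X t p ->
  (\int[P t]_x (G t x * p x)%:E <= (c t)%:E)%E.

(** The observation at time [t] is a function of the first [t.+1] latent
    variables, hence it is known at every later time. *)
Lemma measurable_observation_past k (t : 'I_K) : (t < k)%N ->
  measurable_fun [set: past k]
    ((fun s => omega s t) : past k -> borel (Omega t)).
Proof.
move=> tk; have [_ obs _] := Homega; have [f [mf omegaE]] := obs t.
rewrite (_ : (fun _ => _) = f \o history t.+1); last first.
  by apply/funext => s; exact: omegaE.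
exact: measurableT_comp (measurable_latent_history_past tk).
Qed.

Lemma measurable_observation (t : 'I_K) :
  measurable_fun [set: S] ((fun s => omega s t) : S -> borel (Omega t)).
Proof.
move=> _ A mA; rewrite setTI; apply: (@measurable_past K).
have := measurable_observation_past (ltn_ord t) measurableT mA.
by rewrite setTI.
Qed.

(** Divided by the products of the bounds, the products of weights form a
    supermartingale: given the past of time [k], the weights of the earlier
    observations are known, and the next weight has conditional expectation at
    most its bound. *)
Lemma expectation_prod_le k : (k <= K)%N ->
  (\int[Pr]_s (\prod_(t < K | (t < k)%N) G t (omega s t))%:E <=
   (\prod_(t < K | (t < k)%N) c t)%:E)%E.
Proof.
elim: k => [_|k IH kK].
  rewrite big_pred0//; under eq_integral do rewrite big_pred0//.
  rewrite integral_cst//. rewrite mul1e; exact: probability_le1.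
pose t := Ordinal kK.
have splitP (F : 'I_K -> R) : \prod_(u < K | (u < k.+1)%N) F u =
    (\prod_(u < K | (u < k)%N) F u) * F t.
  rewrite (bigD1 t)//= mulrC; congr (_ * _); apply: eq_bigl => u.
  by rewrite ltnS (ltn_neqAle u) andbC.
rewrite splitP mulrC EFinM; under eq_integral do rewrite splitP.
have [_ _ /(_ t)[p [Pp Xp pw]]] := Homega.
pose F (s : past t) := \prod_(u < K | (u < k)%N) G u (omega s u).
apply: (@le_trans _ _ ((c t)%:E * \int[Pr]_s (F s)%:E)%E); last first.
  by apply: lee_wpmul2l; [rewrite lee_fin|apply: IH; exact: ltnW].
apply: (@ge0_le_integral_mul _ S _ (past t) R Pr idfun _ F (c t)) => //.
- by move=> _ A mA; rewrite setTI; exact: measurable_past mA.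
- by apply: measurableT_comp => //; exact: measurable_observation.
- by move=> s; exact: prodr_ge0.
- have -> : F = fun s => \prod_(u < K) if (u < k)%N then G u (omega s u) else 1.
    by apply/funext => s; rewrite /F big_mkcond.
  apply: measurable_prod => u _; case uk: (u < k)%N; last exact: measurable_cst.
  exact: measurableT_comp (measurable_observation_past uk).
- move=> A mA; apply: (@integral_conditional_le t _ p) => //.
  + exact: measurable_observation.
  + by move=> s; exact: dPfam.
  + by move=> s; exact: Gc.
Qed.

End likelihood_bound.

(** * The aggregated detector of one observation *)

Lemma measurable_ord_maxr d (T : measurableType d) (R : realType) k
    (F : 'I_k.+1 -> T -> R) :
  (forall i, measurable_fun [set: T] (F i)) ->
  measurable_fun [set: T] (fun x => ord_maxr (F ^~ x)).
Proof.
move=> mF; rewrite /ord_maxr; elim: (index_enum _) => [|i s IH].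
  by under eq_fun do rewrite big_nil; exact: mF.
under eq_fun do rewrite big_cons.
by apply: measurable_maxr => //; exact: IH.
Qed.

Lemma measurable_ord_minr d (T : measurableType d) (R : realType) k
    (F : 'I_k.+1 -> T -> R) :
  (forall i, measurable_fun [set: T] (F i)) ->
  measurable_fun [set: T] (fun x => ord_minr (F ^~ x)).
Proof.
move=> mF; rewrite /ord_minr; elim: (index_enum _) => [|i s IH].
  by under eq_fun do rewrite big_nil; exact: mF.
under eq_fun do rewrite big_cons.
by apply: measurable_minr => //; exact: IH.
Qed.

Lemma measurable_aggregate d (T : measurableType d) (R : realType) m n
    (phi : 'I_m.+1 -> 'I_n.+1 -> T -> R) (g : 'cV[R]_m.+1) (h : 'cV[R]_n.+1) :
  (forall i j, measurable_fun [set: T] (phi i j)) ->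
  measurable_fun [set: T] (aggregate phi g h).
Proof.
move=> mphi; apply: (@measurable_ord_maxr _ _ _ _ (fun i w =>
  ord_minr (fun j => phi i j w - ln (h j 0 / g i 0)))) => i.
apply: (@measurable_ord_minr _ _ _ _ (fun j w =>
  phi i j w - ln (h j 0 / g i 0))) => j.
by apply: measurable_funB.
Qed.

Lemma ord_maxr_ge (R : realType) k (F : 'I_k.+1 -> R) i : F i <= ord_maxr F.
Proof. exact: le_bigmax. Qed.

Lemma ord_minr_le (R : realType) k (F : 'I_k.+1 -> R) i : ord_minr F <= F i.
Proof. exact: bigmin_le. Qed.

Lemma ord_maxr_eq (R : realType) k (F : 'I_k.+1 -> R) :
  exists i, ord_maxr F = F i.
Proof.
apply: (big_ind (fun x => exists i, x = F i)) => [|_ _ [i ->] [j ->]|i _].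
- by exists ord0.
- by case: (leP (F i) (F j)) => _; [exists j|exists i].
- by exists i.
Qed.

Lemma ord_minr_eq (R : realType) k (F : 'I_k.+1 -> R) :
  exists i, ord_minr F = F i.
Proof.
apply: (big_ind (fun x => exists i, x = F i)) => [|_ _ [i ->] [j ->]|i _].
- by exists ord0.
- by case: (leP (F i) (F j)) => _; [exists i|exists j].
- by exists i.
Qed.

(** The maximum over rows is at least the minimum of row [i], attained at some
    column; the exponential of the opposite of that entry is one term of the
    sum. *)
Lemma expRN_aggregate_le (R : realType) T m n
    (phi : 'I_m.+1 -> 'I_n.+1 -> T -> R) (g : 'cV[R]_m.+1) (h : 'cV[R]_n.+1)
    (i : 'I_m.+1) (w : T) :
  (forall i, 0 < g i 0) -> (forall j, 0 < h j 0) ->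
  expR (- aggregate phi g h w) <=
  \sum_(j < n.+1) (h j 0 / g i 0) * expR (- phi i j w).
Proof.
move=> g0 h0.
have [j Fi] := ord_minr_eq (fun j => phi i j w - ln (h j 0 / g i 0)).
apply: (@le_trans _ _ (expR (ln (h j 0 / g i 0) - phi i j w))).
  rewrite ler_expR lerNl opprB -Fi.
  exact: (ord_maxr_ge
    (fun i => ord_minr (fun j => phi i j w - ln (h j 0 / g i 0)))).
rewrite expRD lnK ?posrE ?divr_gt0// (bigD1 j)//= lerDl sumr_ge0// => k _.
by rewrite mulr_ge0 ?expR_ge0// divr_ge0// ltW.
Qed.

(** The maximum over rows is attained at some row, whose minimum is at most its
    entry in column [j]; the exponential of that entry is one term of the sum. *)
Lemma expR_aggregate_le (R : realType) T m n
    (phi : 'I_m.+1 -> 'I_n.+1 -> T -> R) (g : 'cV[R]_m.+1) (h : 'cV[R]_n.+1)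
    (j : 'I_n.+1) (w : T) :
  (forall i, 0 < g i 0) -> (forall j, 0 < h j 0) ->
  expR (aggregate phi g h w) <=
  \sum_(i < m.+1) (g i 0 / h j 0) * expR (phi i j w).
Proof.
move=> g0 h0; rewrite /aggregate.
have [i ->] := ord_maxr_eq
  (fun i => ord_minr (fun j => phi i j w - ln (h j 0 / g i 0))).
apply: (@le_trans _ _ (expR (phi i j w - ln (h j 0 / g i 0)))).
  rewrite ler_expR.
  exact: (ord_minr_le (fun j => phi i j w - ln (h j 0 / g i 0))).
rewrite expRD expRN lnK ?posrE ?divr_gt0// invf_div mulrC.
rewrite (bigD1 i)//= lerDl sumr_ge0// => k _.
by rewrite mulr_ge0 ?expR_ge0// divr_ge0// ltW.
Qed.

Lemma integral_weighted_sum_le d (T : measurableType d) (R : realType)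
    (mu : {measure set T -> \bar R}) n (a e : 'I_n -> R) (u : T -> R)
    (v : 'I_n -> T -> R) (p : T -> R) :
  (forall i, 0 <= a i) ->
  (forall x, 0 <= p x) -> measurable_fun [set: T] p ->
  (forall x, 0 <= u x) -> measurable_fun [set: T] u ->
  (forall i x, 0 <= v i x) -> (forall i, measurable_fun [set: T] (v i)) ->
  (forall x, u x <= \sum_(i < n) a i * v i x) ->
  (forall i, \int[mu]_x (v i x * p x)%:E <= (e i)%:E)%E ->
  (\int[mu]_x (u x * p x)%:E <= (\sum_(i < n) a i * e i)%:E)%E.
Proof.
move=> a0 p0 mp u0 mu_ v0 mv uv ve.
have mvp i : measurable_fun [set: T] (fun x => (v i x * p x)%:E).
  by apply/measurable_EFinP/measurable_funM.
apply: (@le_trans _ _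
    (\int[mu]_x (\sum_(i < n) ((a i)%:E * (v i x * p x)%:E)))%E).
  apply: ge0_le_integral => //.
  - by move=> x _; rewrite lee_fin mulr_ge0.
  - by apply/measurable_EFinP/measurable_funM.
  - by apply: emeasurable_sum => i; exact: measurable_funeM.
  - move=> x _; under eq_bigr do rewrite -EFinM mulrA.
    by rewrite sumEFin lee_fin -mulr_suml ler_wpM2r.
rewrite ge0_integral_sum//; last 2 first.
- by move=> i; exact: measurable_funeM.
- by move=> i x _; rewrite lee_fin !mulr_ge0.
rewrite -sumEFin; apply: lee_sum => i _; rewrite ge0_integralZl_EFin//.
- by rewrite EFinM lee_wpmul2l// lee_fin.
- by move=> x _; rewrite lee_fin mulr_ge0.
Qed.

Section aggregate_integral.
Context d (T : measurableType d) (R : realType).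
Variable mu : {measure set T -> \bar R}.
Variables (m n : nat) (phi : 'I_m.+1 -> 'I_n.+1 -> T -> R).
Variables (E : 'M[R]_(m.+1, n.+1)) (g : 'cV[R]_m.+1) (h : 'cV[R]_n.+1) (e : R).
Hypothesis mphi : forall i j, measurable_fun [set: T] (phi i j).
Hypothesis g_gt0 : forall i, 0 < g i 0.
Hypothesis h_gt0 : forall j, 0 < h j 0.

(** The shifts [ln (h j 0 / g i 0)] weight the entries of row [i] by [h j 0], up
    to the factor [g i 0]; the resulting bound is the [i]-th row of the
    eigenvector equation. *)
Lemma integral_expRN_aggregate_le i (p : T -> R) :
  E *m h = e *: g ->
  (forall x, 0 <= p x) -> measurable_fun [set: T] p ->
  (forall j, \int[mu]_x (expR (- phi i j x) * p x)%:E <= (E i j)%:E)%E ->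
  (\int[mu]_x (expR (- aggregate phi g h x) * p x)%:E <= e%:E)%E.
Proof.
move=> Eh p0 mp phi_le.
have -> : e = \sum_(j < n.+1) (h j 0 / g i 0) * E i j.
  move/matrixP/(_ i 0): Eh; rewrite !mxE => Ehi.
  apply: (mulIf (lt0r_neq0 (g_gt0 i))); rewrite -Ehi mulr_suml.
  by apply: eq_bigr => j _; rewrite mulrAC divfK ?lt0r_neq0// mulrC.
apply: (@integral_weighted_sum_le _ _ _ _ _ _ _ _
  (fun j x => expR (- phi i j x))) => //.
- by move=> j; rewrite divr_ge0// ltW.
- apply: measurableT_comp => //; apply: measurable_funN.
  exact: measurable_aggregate.
- by move=> j; apply: measurableT_comp => //; exact: measurable_funN.
- by move=> x; exact: expRN_aggregate_le.
Qed.

(** The same shifts enter with the opposite sign and weight the entries of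
    column [j] by [g i 0], which calls for the transposed equation. *)
Lemma integral_expR_aggregate_le j (p : T -> R) :
  E^T *m g = e *: h ->
  (forall x, 0 <= p x) -> measurable_fun [set: T] p ->
  (forall i, \int[mu]_x (expR (phi i j x) * p x)%:E <= (E i j)%:E)%E ->
  (\int[mu]_x (expR (aggregate phi g h x) * p x)%:E <= e%:E)%E.
Proof.
move=> Eg p0 mp phi_le.
have -> : e = \sum_(i < m.+1) (g i 0 / h j 0) * E i j.
  move/matrixP/(_ j 0): Eg; rewrite !mxE => Egj.
  apply: (mulIf (lt0r_neq0 (h_gt0 j))); rewrite -Egj mulr_suml.
  apply: eq_bigr => i _.
  by rewrite mulrAC divfK ?lt0r_neq0// mxE mulrC.
apply: (@integral_weighted_sum_le _ _ _ _ _ _ _ _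
  (fun i x => expR (phi i j x))) => //.
- by move=> i; rewrite divr_ge0// ltW.
- by apply: measurableT_comp => //; exact: measurable_aggregate.
- by move=> i; exact: measurableT_comp.
- by move=> x; exact: expR_aggregate_le.
Qed.

End aggregate_integral.

(** * The risk of the test *)

(** The Chernoff bound: on [A] the exponential of the accumulated [psi] is at
    least 1, and its expectation is at most the product of the one-step bounds.
    Both error probabilities are instances, with opposite signs of [psi]. *)
Lemma hypothesis_prob_le {R : realType} {K : nat}
    (Omega : 'I_K -> ptopologicalType)
    (P : forall t, {sigma_finite_measure set (borel (Omega t)) -> \bar R})
    (Pfam X : forall t, set (Omega t -> R)) (psi : forall t, Omega t -> R)
    (c : 'I_K -> R) (mu : probability (obs_space Omega) R)
    (A : set (obs_space Omega)) :
  (forall t, Pfam t `<=` borel_densities (P t)) ->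
  (forall t,
    measurable_fun [set: borel (Omega t)] (psi t : borel (Omega t) -> R)) ->
  (forall t, 0 <= c t) ->
  (forall t p, X t p ->
    (\int[P t]_x (expR (psi t x) * p x)%:E <= (c t)%:E)%E) ->
  measurable A -> (forall w, A w -> 0 <= \sum_(t < K) psi t (w t)) ->
  hypothesis P Pfam X mu -> (mu A <= (\prod_(t < K) c t)%:E)%E.
Proof.
move=> dPfam mpsi c0 psi_le mA A0.
move=> [dS [S [Pr [dZ [Z [zeta [omega [gen ->//]]]]]]]].
have [mzeta _ _] := gen.
have mG t : measurable_fun [set: borel (Omega t)]
    ((fun x => expR (psi t x)) : borel (Omega t) -> R).
  exact: measurableT_comp.
have momega t :
    measurable_fun [set: S] ((fun s => omega s t) : S -> borel (Omega t)).
  exact: (measurable_observation mzeta gen).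
have momegaA : measurable (omega @^-1` A).
  rewrite -[X in measurable X]setTI.
  by apply: (measurable_prod_space momega).
have allK (F : 'I_K -> R) :
    \prod_(t < K | (t < K)%N) F t = \prod_(t < K) F t.
  by apply: eq_bigl => t; rewrite ltn_ord.
have := expectation_prod_le mzeta dPfam gen (fun t x => expR_ge0 (psi t x))
  mG c0 psi_le (leqnn K).
rewrite allK; under eq_integral do rewrite allK.
apply: le_trans.
have mprod : measurable_fun [set: S]
    (fun s => (\prod_(t < K) expR (psi t (omega s t)))%:E).
  apply/measurable_EFinP/measurable_prod => t _.
  exact: (measurableT_comp (mG t) (momega t)).
rewrite -[X in (X <= _)%E]mul1e -(@integral_cst _ _ _ Pr _ momegaA 1%E).
apply: (@le_trans _ _
    (\int[Pr]_(s in omega @^-1` A)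
       (\prod_(t < K) expR (psi t (omega s t)))%:E)%E).
  apply: ge0_le_integral => //.
  - exact: measurable_funTS.
  - by move=> s As; rewrite lee_fin -expR_sum -expR0 ler_expR; exact: A0.
apply: ge0_subset_integral => //.
by move=> s _; rewrite lee_fin prodr_ge0// => t _; exact: expR_ge0.
Qed.

Theorem proposition3p2 (R : realType) (K : nat)
    (Omega : 'I_K -> ptopologicalType)
    (HOmega : forall t, polish R (Omega t))
    (P : forall t, {sigma_finite_measure set (borel (Omega t)) -> \bar R})
    (Pfam : forall t, set (Omega t -> R))
    (HPfam : forall t, Pfam t `<=` borel_densities (P t))
    (m n : 'I_K -> nat)
    (X : forall t, 'I_(m t).+1 -> set (Omega t -> R))
    (Y : forall t, 'I_(n t).+1 -> set (Omega t -> R))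
    (HX : forall t i, X t i !=set0 /\ X t i `<=` Pfam t)
    (HY : forall t j, Y t j !=set0 /\ Y t j `<=` Pfam t)
    (phi : forall t, 'I_(m t).+1 -> 'I_(n t).+1 -> Omega t -> R)
    (Hphi : forall t i j,
      measurable_fun [set: borel (Omega t)] (phi t i j : borel (Omega t) -> R))
    (E : forall t, 'M[R]_((m t).+1, (n t).+1))
    (HE : forall t i j, 0 < E t i j)
    (HphiX : forall t i j p, X t i p ->
      (\int[P t]_w (expR (- phi t i j w) * p w)%:E <= (E t i j)%:E)%E)
    (HphiY : forall t i j p, Y t j p ->
      (\int[P t]_w (expR (phi t i j w) * p w)%:E <= (E t i j)%:E)%E)
    (g : forall t, 'cV[R]_(m t).+1)
    (h : forall t, 'cV[R]_(n t).+1)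
    (Hg : forall t i, 0 < g t i 0)
    (Hh : forall t j, 0 < h t j 0)
    (HEh : forall t, E t *m h t = spectral_norm (E t) *: g t)
    (HEg : forall t, (E t)^T *m g t = spectral_norm (E t) *: h t) :
  let X_ t := \bigcup_(i in [set: 'I_(m t).+1]) X t i in
  let Y_ t := \bigcup_(j in [set: 'I_(n t).+1]) Y t j in
  let phi_ t := aggregate (phi t) (g t) (h t) in
  let phiK (w : obs_space Omega) := \sum_(t < K) phi_ t (w t) in
  (forall t,
    (forall p, X_ t p ->
      (\int[P t]_w (expR (- phi_ t w) * p w)%:E
         <= (spectral_norm (E t))%:E)%E) /\
    (forall p, Y_ t p ->
      (\int[P t]_w (expR (phi_ t w) * p w)%:E
         <= (spectral_norm (E t))%:E)%E)) /\
  (risk (hypothesis P Pfam X_) (hypothesis P Pfam Y_) [set w | (0 <= phiK w)%R]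
     <= (\prod_(t < K) spectral_norm (E t))%:E)%E.
Proof.
move=> X_ Y_ phi_ phiK.
have E_ge0 t : 0 <= spectral_norm (E t).
  move/matrixP/(_ 0 0): (HEh t); rewrite !mxE => Eg.
  rewrite -(pmulr_lge0 _ (Hg t 0)) -Eg sumr_ge0// => j _.
  by rewrite mulr_ge0// ltW.
have X_le t p : X_ t p ->
    (\int[P t]_w (expR (- phi_ t w) * p w)%:E <= (spectral_norm (E t))%:E)%E.
  move=> [i _ Xp]; have [mp p0 _] := HPfam _ _ ((HX t i).2 _ Xp).
  apply: (@integral_expRN_aggregate_le _ _ _ _ _ _ _ (E t) _ _ _ _ _ _ i) => //.
  by move=> j; exact: HphiX.
have Y_le t p : Y_ t p ->
    (\int[P t]_w (expR (phi_ t w) * p w)%:E <= (spectral_norm (E t))%:E)%E.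
  move=> [j _ Yp]; have [mp p0 _] := HPfam _ _ ((HY t j).2 _ Yp).
  apply: (@integral_expR_aggregate_le _ _ _ _ _ _ _ (E t) _ _ _ _ _ _ j) => //.
  by move=> i; exact: HphiY.
split=> [t|]; first by split; [exact: X_le|exact: Y_le].
have mphi_ t :
    measurable_fun [set: borel (Omega t)] (phi_ t : borel (Omega t) -> R).
  exact: measurable_aggregate.
have mphiK : measurable_fun [set: obs_space Omega] phiK.
  apply: measurable_sum => t.
  exact: (measurableT_comp (mphi_ t)
    (@measurable_coord _ _ (fun t => borel (Omega t)) t)).
have macc : measurable ([set w | 0 <= phiK w] : set (obs_space Omega)).
  rewrite -preimage_itvcy -[X in measurable X]setTI.
  by apply: mphiK => //; exact: measurable_itv.
apply: ereal_inf_lbound; exists (\prod_(t < K) spectral_norm (E t)) => //.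
split=> mu; [apply: (hypothesis_prob_le (psi := fun t w => - phi_ t w)) => //|
             apply: (hypothesis_prob_le (psi := phi_)) => //].
- by move=> t; exact: measurable_funN.
- exact: measurableC.
- by move=> w /negP; rewrite -ltNge sumrN oppr_ge0 => /ltW.
Qed.
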